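(* Let $m\ge n$, and let $A\in\mathbb{R}^{m\times m}$, $B\in\mathbb{R}^{n\times n}$ be diagonalizable (over $\mathbb{C}$), with eigendecompositions $$A=V_AD_AV_A^{-1},\quad D_A=\operatorname{diag}(\lambda_1,\dots,\lambda_m),\qquad B=V_BD_BV_B^{-1},\quad D_B=\operatorname{diag}(\mu_1,\dots,\mu_n),$$ where $V_A,D_A\in\mathbb{C}^{m\times m}$ and $V_B,D_B\in\mathbb{C}^{n\times n}$. Let $C\in\mathbb{R}^{m\times n}$. Assume that $\lambda_i\ne\mu_j$ for all $i,j$, and define $\widetilde C=V_A^{-1}CV_B\in\mathbb{C}^{m\times n}$ and $R\in\mathbb{C}^{m\times n}$ by $R_{ij}=\frac{1}{\lambda_i-\mu_j}$. Then the unique solution to the Sylvester equation $AX-XB=C$ is $$X=V_A(\widetilde C\circ R)V_B^{-1}.$$ If $X$ has full rank, then $$\frac{\kappa_2(\widetilde C\circ R)}{\kappa_2(V_A)\,\kappa_2(V_B)}\le\kappa_2(X)\le\kappa_2(V_A)\,\kappa_2(V_B)\,\kappa_2(\widetilde C\circ R).$$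
   Context: $\circ$ denotes the Hadamard (entrywise) product. For a nonzero matrix $M$ of rank $r$, $\kappa_2(M)=\|M\|_2\|M^{+}\|_2=\sigma_1(M)/\sigma_r(M)$, where $M^+$ is the Moore--Penrose pseudoinverse and $\sigma_1(M)\ge\sigma_2(M)\ge\cdots$ are the singular values. *)

(* Defs.v *)
From mathcomp Require Import all_boot all_order all_algebra.
From mathcomp Require Import all_classical all_reals.
From mathcomp Require Export complex.

Set Implicit Arguments.
Unset Strict Implicit.
Unset Printing Implicit Defensive.

Import Order.TTheory GRing.Theory Num.Theory.
Local Open Scope ring_scope.
Local Open Scope classical_set_scope.
Local Open Scope sesquilinear_scope.
Local Open Scope complex_scope.

Definition to_complex (R : realType) m n (A : 'M[R]_(m, n)) : 'M[R[i]]_(m, n) :=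
  map_mx (real_complex R) A.

Definition hadamard (K : pzRingType) m n (A B : 'M[K]_(m, n)) : 'M[K]_(m, n) :=
  map2_mx *%R A B.

(* [Normc.normc] is the modulus with values in R; `|z| would live in R[i]. *)
Definition vnorm2 (R : realType) n (x : 'cV[R[i]]_n) : R :=
  Num.sqrt (\sum_i Normc.normc (x i 0) ^+ 2).

(* The spectral norm, as operator norm; it equals sigma_1(M), and on
   [to_complex A] it is the 2-norm of the real matrix A. *)
Definition norm2 (R : realType) m n (M : 'M[R[i]]_(m, n)) : R :=
  sup [set vnorm2 (M *m x) | x in [set x : 'cV[R[i]]_n | vnorm2 x <= 1]].

(* The four Penrose equations. *)
Definition is_mpinv (R : realType) m n
    (M : 'M[R[i]]_(m, n)) (P : 'M[R[i]]_(n, m)) : Prop :=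
  [/\ M *m P *m M = M, P *m M *m P = P,
      (M *m P)^t* = M *m P & (P *m M)^t* = P *m M].

(* The default value 0 plays no role, see [mpinvP] and [is_mpinv_uniq].  The
   [pinvmx] of MathComp is only a partial inverse, not the Moore-Penrose one. *)
Definition mpinv (R : realType) m n (M : 'M[R[i]]_(m, n)) : 'M[R[i]]_(n, m) :=
  xget 0 [set P | is_mpinv M P].

(* Equal to sigma_1(M) / sigma_r(M) for M of rank r > 0, and to 0 for M = 0. *)
Definition kappa2 (R : realType) m n (M : 'M[R[i]]_(m, n)) : R :=
  norm2 M * norm2 (mpinv M).

Lemma normc_ge0 (R : rcfType) (z : R[i]) : 0 <= Normc.normc z.
Proof. by case: z => a b; rewrite sqrtr_ge0. Qed.

Lemma vnorm2_ge0 (R : realType) n (x : 'cV[R[i]]_n) : 0 <= vnorm2 x.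
Proof. exact: sqrtr_ge0. Qed.

Lemma normc_le_vnorm2 (R : realType) n (x : 'cV[R[i]]_n) i :
  Normc.normc (x i 0) <= vnorm2 x.
Proof.
rewrite -(@ger0_norm _ (Normc.normc _)) ?normc_ge0// -sqrtr_sqr ler_wsqrtr//.
by rewrite (bigD1 i)//= lerDl sumr_ge0// => j _; rewrite sqr_ge0.
Qed.

Lemma normc_sum (R : rcfType) (I : Type) (r : seq I) (F : I -> R[i]) :
  Normc.normc (\sum_(k <- r) F k) <= \sum_(k <- r) Normc.normc (F k).
Proof.
elim/big_rec2: _ => [|k y1 y2 _ le12]; first by rewrite Normc.normc0.
exact: le_trans (le_normcD _ _) (lerD _ le12).
Qed.

(* The supremum defining [norm2] is taken over a nonempty bounded set. *)
Lemma norm2_has_sup (R : realType) m n (M : 'M[R[i]]_(m, n)) :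
  has_sup [set vnorm2 (M *m x) | x in [set x : 'cV[R[i]]_n | vnorm2 x <= 1]].
Proof.
split.
  exists (vnorm2 (M *m 0)), 0 => //=.
  rewrite /vnorm2 big1 ?sqrtr0// => i _.
  by rewrite mxE Normc.normc0 expr0n.
exists (Num.sqrt (\sum_i (\sum_j Normc.normc (M i j)) ^+ 2)) => _ [x /= x1 <-].
apply: ler_wsqrtr; apply: ler_sum => i _; rewrite lerXn2r ?nnegrE ?normc_ge0//.
  by rewrite sumr_ge0// => j _; exact: normc_ge0.
rewrite mxE; apply: le_trans (normc_sum _ _) _; apply: ler_sum => j _.
rewrite Normc.normcM ler_piMr ?normc_ge0//.
exact: le_trans (normc_le_vnorm2 x j) x1.
Qed.

Lemma trmxC_mul (C : numClosedFieldType) m n p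
    (A : 'M[C]_(m, n)) (B : 'M[C]_(n, p)) :
  (A *m B)^t* = B^t* *m A^t*.
Proof. by rewrite trmx_mul map_mxM. Qed.

Lemma mulmx_trmxC_eq0 (C : numClosedFieldType) n (u : 'rV[C]_n) :
  u *m u^t* = 0 -> u = 0.
Proof.
move=> /matrixP/(_ 0 0); rewrite !mxE.
under eq_bigr do rewrite !mxE -normCK.
move=> /eqP; rewrite psumr_eq0 => [/allP u0|j _]; last exact: exprn_ge0.
apply/rowP => j; have := u0 j (mem_index_enum _).
by rewrite /= sqrf_eq0 normr_eq0 !mxE => /eqP.
Qed.

Lemma gram_row_free_unit (C : numClosedFieldType) r n (F : 'M[C]_(r, n)) :
  row_free F -> F *m F^t* \in unitmx.
Proof.
move=> freeF; rewrite -row_free_unit -kermx_eq0; apply/eqP/row_matrixP => i.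
rewrite row0; set v := row i _.
have vF : v *m (F *m F^t*) = 0 by rewrite -row_mul mulmx_ker row0.
apply/eqP; rewrite -(mulmx_free_eq0 _ freeF); apply/eqP/mulmx_trmxC_eq0.
by rewrite trmxC_mul mulmxA -[v *m F *m _]mulmxA vF mul0mx.
Qed.

Lemma gram_trmxC_inv (C : numClosedFieldType) r n (F : 'M[C]_(r, n)) :
  (invmx (F *m F^t*))^t* = invmx (F *m F^t*).
Proof. by rewrite trmx_inv map_invmx trmxC_mul trmxCK. Qed.

Lemma is_mpinv_fullrank (R : realType) m n r
    (L : 'M[R[i]]_(r, m)) (F : 'M[R[i]]_(r, n)) : row_free L -> row_free F ->
  is_mpinv (L^t* *m F)
    (F^t* *m invmx (F *m F^t*) *m (invmx (L *m L^t*) *m L)).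
Proof.
move=> /gram_row_free_unit uL /gram_row_free_unit uF.
set M := L^t* *m F.
set iF := invmx (F *m F^t*); set iL := invmx (L *m L^t*).
have MP : M *m (F^t* *m iF *m (iL *m L)) = L^t* *m (iL *m L).
  by rewrite -!mulmxA (mulmxA F) (mulmxA (F *m F^t*)) mulmxV// mul1mx.
have PM : F^t* *m iF *m (iL *m L) *m M = F^t* *m iF *m F.
  by rewrite -!mulmxA (mulmxA L) (mulmxA iL) mulVmx// mul1mx.
split.
- by rewrite MP -!mulmxA (mulmxA L) (mulmxA iL) mulVmx// mul1mx.
- by rewrite PM -!mulmxA (mulmxA F) (mulmxA (F *m F^t*)) mulmxV// mul1mx.
- by rewrite MP !trmxC_mul gram_trmxC_inv trmxCK mulmxA.
- by rewrite PM !trmxC_mul gram_trmxC_inv trmxCK mulmxA.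
Qed.

Lemma is_mpinv_exists (R : realType) m n (M : 'M[R[i]]_(m, n)) :
  exists P, is_mpinv M P.
Proof.
have freeL : row_free ((col_base M)^t*).
  by rewrite /row_free mxrank_map mxrank_tr; exact: col_base_full.
have := is_mpinv_fullrank freeL (row_base_free M).
by rewrite trmxCK mulmx_base => MP; eexists; exact: MP.
Qed.

Lemma is_mpinv_uniq (R : realType) m n (M : 'M[R[i]]_(m, n)) P Q :
  is_mpinv M P -> is_mpinv M Q -> P = Q.
Proof.
move=> [MPM PMP sMP sPM] [MQM QMQ sMQ sQM].
have PQ : M *m P = M *m Q.
  rewrite -sMP -{1}MQM -(mulmxA (M *m Q)) trmxC_mul sMP sMQ.
  by rewrite !mulmxA MPM.
have QP : P *m M = Q *m M.
  rewrite -sPM -{1}MQM -mulmxA mulmxA trmxC_mul sPM sQM.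
  by rewrite -!mulmxA (mulmxA M) MPM.
by rewrite -PMP -mulmxA PQ mulmxA QP QMQ.
Qed.

Lemma mpinvP (R : realType) m n (M : 'M[R[i]]_(m, n)) : is_mpinv M (mpinv M).
Proof. by have [P MP] := is_mpinv_exists M; exact: (xgetPex 0 (ex_intro _ P MP)). Qed.

(* Main.v *)
(** Writing H for the Hadamard product, X = V_A H V_B^-1, so norm2 X is at most
    norm2 V_A * norm2 H * norm2 V_B^-1.  Since X has full column rank, its
    Moore-Penrose inverse is its left inverse of smallest norm, because
    X^+ = L (X X^+) for any left inverse L and X X^+ is an orthogonal projection;
    taking L = V_B H^+ V_A^-1 bounds norm2 X^+.  The lower bound is the upper bound
    applied to H = V_A^-1 X V_B.  Finally X is real because its conjugate solves
    the same equation, whose solution is unique. *)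
Require Import Defs.
From mathcomp Require Import all_boot all_order all_algebra.
From mathcomp Require Import all_classical all_reals.
From mathcomp Require Import ring.

Import Order.TTheory GRing.Theory Num.Theory.
Local Open Scope ring_scope.

Section Norm2.
Context {R : realType}.
Local Open Scope sesquilinear_scope.
Local Open Scope complex_scope.

Lemma sqr_vnorm2 n (x : 'cV[R[i]]_n) :
  vnorm2 x ^+ 2 = \sum_i Normc.normc (x i 0) ^+ 2.
Proof. by rewrite sqr_sqrtr // sumr_ge0 // => i _; rewrite sqr_ge0. Qed.

(** Recasts the real number as a 1 x 1 complex matrix, so that Pythagoras in [norm2_orthoproj]
    becomes plain matrix algebra. *)
Lemma vnorm2E n (x : 'cV[R[i]]_n) :
  ((vnorm2 x ^+ 2)%:C)%:M = x^t* *m x :> 'M_1.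
Proof.
apply/matrixP => i j; rewrite !ord1 sqr_vnorm2 !mxE eqxx mulr1n rmorph_sum.
apply: eq_bigr => k _; rewrite !mxE mulrC -normCK.
by rewrite rmorphXn.
Qed.

Lemma vnorm20 n : vnorm2 (0 : 'cV[R[i]]_n) = 0.
Proof.
by rewrite /vnorm2 big1 ?sqrtr0// => i _; rewrite mxE Normc.normc0 expr0n.
Qed.

Lemma vnorm2_eq0 n (x : 'cV[R[i]]_n) : vnorm2 x = 0 -> x = 0.
Proof.
move=> x0; apply/colP => i; rewrite mxE; apply: Normc.eq0_normc.
by apply/eqP; rewrite eq_le normc_ge0 -x0 normc_le_vnorm2.
Qed.

Lemma vnorm2Z n (c : R) (x : 'cV[R[i]]_n) :
  0 <= c -> vnorm2 (c%:C *: x) = c * vnorm2 x.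
Proof.
move=> c0; rewrite /vnorm2 -{2}(ger0_norm c0) -sqrtr_sqr -sqrtrM ?sqr_ge0//.
rewrite mulr_sumr; congr Num.sqrt; apply: eq_bigr => i _.
by rewrite mxE Normc.normcM exprMn /= expr0n /= addr0 sqr_sqrtr ?sqr_ge0.
Qed.

Lemma vnorm2_norm2_le1 {m n} (M : 'M[R[i]]_(m, n)) x :
  vnorm2 x <= 1 -> vnorm2 (M *m x) <= norm2 M.
Proof.
by move=> x1; apply: ub_le_sup; [case: (norm2_has_sup M)|exists x].
Qed.

Lemma norm2_ge0 {m n} (M : 'M[R[i]]_(m, n)) : 0 <= norm2 M.
Proof.
apply: le_trans (vnorm2_norm2_le1 M 0 _); first exact: vnorm2_ge0.
by rewrite vnorm20 ler01.
Qed.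

Lemma vnorm2_mulmx {m n} (M : 'M[R[i]]_(m, n)) x :
  vnorm2 (M *m x) <= norm2 M * vnorm2 x.
Proof.
have [x0|xN0] := eqVneq (vnorm2 x) 0.
  by rewrite (vnorm2_eq0 _ _ x0) mulmx0 !vnorm20 mulr0.
have x_gt0 : 0 < vnorm2 x by rewrite lt_def xN0 vnorm2_ge0.
have xV_ge0 : 0 <= (vnorm2 x)^-1 by rewrite invr_ge0 ltW.
rewrite -ler_pdivrMr// mulrC -vnorm2Z// scalemxAr.
by apply: vnorm2_norm2_le1; rewrite vnorm2Z// mulVf.
Qed.

Lemma norm2_le m n (M : 'M[R[i]]_(m, n)) c : 0 <= c ->
  (forall x, vnorm2 (M *m x) <= c * vnorm2 x) -> norm2 M <= c.
Proof.
move=> c0 Mc; apply: ge_sup; first by case: (norm2_has_sup M).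
move=> _ [x /= x1 <-]; apply: le_trans (Mc x) _.
by rewrite ler_piMr.
Qed.

Lemma norm2M {m n p} (M : 'M[R[i]]_(m, n)) (N : 'M[R[i]]_(n, p)) :
  norm2 (M *m N) <= norm2 M * norm2 N.
Proof.
apply: norm2_le => [|x]; first by rewrite mulr_ge0 ?norm2_ge0.
rewrite -mulmxA -mulrA; apply: le_trans (vnorm2_mulmx _ _) _.
by rewrite ler_wpM2l ?norm2_ge0 ?vnorm2_mulmx.
Qed.

(** Pythagoras: [Q *m x] and [x - Q *m x] are orthogonal because [Q] is Hermitian and idempotent. *)
Lemma norm2_orthoproj n (Q : 'M[R[i]]_n) :
  Q^t* = Q -> Q *m Q = Q -> norm2 Q <= 1.
Proof.
move=> sQ QQ; apply: norm2_le => // x; rewrite mul1r.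
rewrite -(@ler_pXn2r _ 2) ?nnegrE ?vnorm2_ge0//.
set y := Q *m x; set z := x - y.
have Qz : Q *m z = 0 by rewrite mulmxBr mulmxA QQ subrr.
have yz : y^t* *m z = 0 by rewrite trmxC_mul sQ -mulmxA Qz mulmx0.
have zy : z^t* *m y = 0 by rewrite -[y]trmxCK -trmxC_mul yz trmx0 map_mx0.
have xE : x = z + y by rewrite subrK.
(* From here on only [xE], [yz] and [zy] matter. *)
clearbody z; clearbody y.
have xyz : vnorm2 x ^+ 2 = vnorm2 y ^+ 2 + vnorm2 z ^+ 2.
  apply: complexI; rewrite rmorphD.
  have /matrixP/(_ 0 0) : (((vnorm2 x ^+ 2)%:C)%:M =
      ((vnorm2 y ^+ 2)%:C)%:M + ((vnorm2 z ^+ 2)%:C)%:M :> 'M_1).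
    have zyT : (z + y)^t* = z^t* + y^t* by rewrite -map_mxD -linearD.
    rewrite !vnorm2E xE zyT mulmxDl !mulmxDr.
    by rewrite yz zy addr0 add0r addrC.
  by rewrite !mxE eqxx !mulr1n.
by rewrite xyz lerDl sqr_ge0.
Qed.

(** Multiply the first Penrose equation by [L] on the left. *)
Lemma mpinv_mulVmx m n (M : 'M[R[i]]_(m, n)) L :
  L *m M = 1%:M -> mpinv M *m M = 1%:M.
Proof.
have [MPM _ _ _] := mpinvP M.
by move=> LM; rewrite -[LHS]mul1mx -LM -mulmxA (mulmxA M) MPM.
Qed.

Lemma mpinv_unit n (M : 'M[R[i]]_n) : M \in unitmx -> mpinv M = invmx M.
Proof.
move=> uM; have PM := mpinv_mulVmx _ _ _ _ (mulVmx uM).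
by rewrite -[LHS]mulmx1 -(mulmxV uM) mulmxA PM mul1mx.
Qed.

Lemma norm2_mpinv_min {m n} (M : 'M[R[i]]_(m, n)) L :
  L *m M = 1%:M -> norm2 (mpinv M) <= norm2 L.
Proof.
move=> LM; have [MPM PMP sMP _] := mpinvP M.
rewrite -[mpinv M]mul1mx -LM -mulmxA; apply: le_trans (norm2M _ _) _.
(* [M *m mpinv M] is Hermitian by the third Penrose equation and idempotent by the first. *)
rewrite ler_piMr ?norm2_ge0// norm2_orthoproj//.
by rewrite mulmxA MPM.
Qed.

Lemma kappa2_ge0 {m n} (M : 'M[R[i]]_(m, n)) : 0 <= kappa2 M.
Proof. by rewrite mulr_ge0 ?norm2_ge0. Qed.

Lemma kappa2_invmx n (M : 'M[R[i]]_n) :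
  M \in unitmx -> kappa2 (invmx M) = kappa2 M.
Proof.
move=> uM; have uVM : invmx M \in unitmx by rewrite unitmx_inv.
by rewrite /kappa2 (mpinv_unit _ _ uM) (mpinv_unit _ _ uVM) invmxK mulrC.
Qed.

(** The hypothesis on [L] encodes full column rank of [N]. Then Q^-1 N^+ P^-1 is a left inverse of P
    N Q; it need not be the Moore-Penrose inverse, but its norm bounds the norm of the latter. *)
Lemma kappa2_mulmx m n (P : 'M[R[i]]_m) (N : 'M[R[i]]_(m, n)) Q L :
  P \in unitmx -> Q \in unitmx -> L *m N = 1%:M ->
  kappa2 (P *m N *m Q) <= kappa2 P * kappa2 Q * kappa2 N.
Proof.
move=> uP uQ /mpinv_mulVmx NN.
rewrite /kappa2 (mpinv_unit _ _ uP) (mpinv_unit _ _ uQ).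
have LPNQ : invmx Q *m mpinv N *m invmx P *m (P *m N *m Q) = 1%:M.
  rewrite !mulmxA mulmxKV// -[_ *m mpinv N *m N]mulmxA NN mulmx1.
  exact: mulVmx.
have le1 : norm2 (P *m N *m Q) <= norm2 P * norm2 N * norm2 Q.
  by apply: le_trans (norm2M _ _) _; rewrite ler_wpM2r ?norm2_ge0 ?norm2M.
have le2 : norm2 (mpinv (P *m N *m Q)) <=
    norm2 (invmx Q) * norm2 (mpinv N) * norm2 (invmx P).
  apply: le_trans (norm2_mpinv_min _ _ LPNQ) _.
  by apply: le_trans (norm2M _ _) _; rewrite ler_wpM2r ?norm2_ge0 ?norm2M.
apply: le_trans (ler_pM (norm2_ge0 _) (norm2_ge0 _) le1 le2) _.
(* Both sides are the same six norms in a different order. *)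
by rewrite le_eqVlt; apply/predU1P; left; ring.
Qed.

End Norm2.

Section Sylvester.
Context {K : fieldType} {m n : nat}.
Implicit Types (C Y : 'M[K]_(m, n)) (lambda : 'rV[K]_m) (mu : 'rV[K]_n).

(** The equation decouples into the scalar equations (lambda_i - mu_j) Y_ij = C_ij. *)
Lemma sylvester_diag lambda mu C Y :
  (forall i j, lambda 0 i <> mu 0 j) ->
  diag_mx lambda *m Y - Y *m diag_mx mu = C <->
  Y = hadamard C (\matrix_(i, j) (1 / (lambda 0 i - mu 0 j))).
Proof.
move=> sep; have sepN0 i j : lambda 0 i - mu 0 j != 0.
  by rewrite subr_eq0; apply/eqP/sep.
split=> [<-|->]; apply/matrixP => i j; rewrite mul_diag_mx mul_mx_diag !mxE.
  by field.
by field.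
Qed.

(** The bijective change of unknown W = VA^-1 Y VB reduces to the diagonal case. The equivalence
    carries both existence and uniqueness. *)
Lemma sylvester_diagonalizable (VA : 'M[K]_m) (VB : 'M[K]_n) lambda mu C Y :
  VA \in unitmx -> VB \in unitmx -> (forall i j, lambda 0 i <> mu 0 j) ->
  VA *m diag_mx lambda *m invmx VA *m Y - Y *m (VB *m diag_mx mu *m invmx VB) = C
  <-> Y = VA *m hadamard (invmx VA *m C *m VB)
            (\matrix_(i, j) (1 / (lambda 0 i - mu 0 j))) *m invmx VB.
Proof.
move=> uA uB sep; have conjK (Z W : 'M[K]_(m, n)) :
    Z = VA *m W *m invmx VB <-> invmx VA *m Z *m VB = W.
  split=> [->|<-]; first by rewrite !mulmxA mulVmx// mul1mx mulmxKV.
  by rewrite !mulmxA mulmxV// mul1mx mulmxK.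
rewrite conjK -sylvester_diag//.
have -> : VA *m diag_mx lambda *m invmx VA *m Y -
          Y *m (VB *m diag_mx mu *m invmx VB) =
    VA *m (diag_mx lambda *m (invmx VA *m Y *m VB) -
           invmx VA *m Y *m VB *m diag_mx mu) *m invmx VB.
  rewrite mulmxBr mulmxBl !mulmxA mulmxK// mulmxV// mul1mx.
  by rewrite -!mulmxA.
by split=> [/esym/conjK//|/esym/conjK/esym].
Qed.

End Sylvester.

Lemma conjC_to_complex (R : realType) m n (M : 'M[R]_(m, n)) :
  map_mx Num.conj (to_complex M) = to_complex M.
Proof.
apply/matrixP => i j; rewrite !mxE.
by apply/conj_Creal/complex_realP; exists (M i j).
Qed.

Lemma to_complex_Re (R : realType) m n (Y : 'M[R[i]]_(m, n)) :
  map_mx Num.conj Y = Y -> to_complex (map_mx (@complex.Re R) Y) = Y.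
Proof.
move=> /matrixP YY; apply/matrixP => i j; have := YY i j; rewrite !mxE.
by move=> /CrealP/RRe_real.
Qed.

Theorem proposition1 (R : realType) (m n : nat) (hmn : (n <= m)%N)
    (A : 'M[R]_m) (B : 'M[R]_n) (C : 'M[R]_(m, n))
    (VA : 'M[R[i]]_m) (lambda : 'rV[R[i]]_m)
    (VB : 'M[R[i]]_n) (mu : 'rV[R[i]]_n)
    (hVA : VA \in unitmx) (hVB : VB \in unitmx)
    (hA : to_complex A = VA *m diag_mx lambda *m invmx VA)
    (hB : to_complex B = VB *m diag_mx mu *m invmx VB)
    (hsep : forall (i : 'I_m) (j : 'I_n), lambda 0 i <> mu 0 j) :
  let Ct : 'M[R[i]]_(m, n) := invmx VA *m to_complex C *m VB in
  let Rm : 'M[R[i]]_(m, n) :=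
    \matrix_(i < m, j < n) (1 / (lambda 0 i - mu 0 j)) in
  exists X : 'M[R]_(m, n),
    [/\ A *m X - X *m B = C,
        forall Y : 'M[R[i]]_(m, n),
          to_complex A *m Y - Y *m to_complex B = to_complex C ->
          Y = to_complex X,
        to_complex X = VA *m hadamard Ct Rm *m invmx VB
      & \rank X = minn m n ->
        kappa2 (hadamard Ct Rm) / (kappa2 VA * kappa2 VB)
          <= kappa2 (to_complex X)
          <= kappa2 VA * kappa2 VB * kappa2 (hadamard Ct Rm)].
Proof.
move=> Ct Rm; set H := hadamard Ct Rm.
have sylv Y : to_complex A *m Y - Y *m to_complex B = to_complex C <->
    Y = VA *m H *m invmx VB by rewrite hA hB; exact: sylvester_diagonalizable.
set Z := VA *m H *m invmx VB in sylv.
have Zsol := (sylv Z).2 erefl.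
have ZR : to_complex (map_mx (@complex.Re R) Z) = Z.
  (* By [sylv], the conjugate of [Z] equals [Z] once it solves the equation; writing [A] and [B] as
     their own conjugates pulls the conjugation out of the left-hand side. *)
  apply/to_complex_Re/sylv; rewrite -[in LHS](conjC_to_complex _ _ _ A).
  rewrite -[to_complex B]conjC_to_complex -!map_mxM -map_mxB Zsol.
  exact: conjC_to_complex.
exists (map_mx (@complex.Re R) Z); split=> //.
- apply: (@map_mx_inj _ _ (real_complex R)).
  by rewrite map_mxB !map_mxM -!/(to_complex _) ZR.
- by move=> Y /sylv ->; rewrite ZR.
(* By [hmn], full rank means full column rank, hence a left inverse [L], found over the reals and
   then complexified. *)
rewrite (minn_idPr hmn) ZR => rkX.
have /row_fullP[L LX] : row_full (map_mx (@complex.Re R) Z) by rewrite /row_full rkX.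
have LZ : to_complex L *m Z = 1%:M by rewrite -ZR -map_mxM LX map_mx1.
(* The change of basis carries the left inverse of [Z] to one of [H], as the upper bound
   requires. *)
have LH : invmx VB *m to_complex L *m VA *m H = 1%:M.
  rewrite -[RHS](mulVmx hVB) -[X in _ = X *m VB]mulmx1 -LZ.
  by rewrite !mulmxA mulmxKV.
apply/andP; split; last first.
  by rewrite -(kappa2_invmx _ VB)//; apply: kappa2_mulmx LH; rewrite ?unitmx_inv.
have HZ : H = invmx VA *m Z *m VB by rewrite !mulmxA mulVmx// mul1mx mulmxKV.
have le : kappa2 H <= kappa2 VA * kappa2 VB * kappa2 Z.
  rewrite {1}HZ -(kappa2_invmx _ VA)//.
  by apply: kappa2_mulmx LZ; rewrite ?unitmx_inv.
(* The product vanishes when [n] is 0, all norms of empty matrices being 0; the quotient is then 0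
   since [invr] sends 0 to 0. *)
have [->|kN0] := eqVneq (kappa2 VA * kappa2 VB) 0.
  by rewrite invr0 mulr0 kappa2_ge0.
have k_gt0 : 0 < kappa2 VA * kappa2 VB by rewrite lt_def kN0 mulr_ge0 ?kappa2_ge0.
by rewrite ler_pdivrMr// mulrC.
Qed.
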